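(* Let $\mathbf{V}$ be a pseudovariety, and let $k \geq 1$. Then the following hold. (1) $\mathbf{T}_{k+1} \not\subseteq \mathbf{V}$ if and only if $\mathbf{V}$ satisfies a nontrivial $k$-ary product identity. (2) $\mathbf{U}_{k+1} \not\subseteq \mathbf{V}$ if and only if $\mathbf{V}$ satisfies a $k$-ary expansion identity; equivalently, if and only if $\mathbf{V}$ satisfies a regular $k$-ary expansion identity. In particular, $\mathbf{T} \not\subseteq \mathbf{V}$ if and only if $\mathbf{V}$ satisfies a nontrivial product identity of some arity, and $\mathbf{U} \not\subseteq \mathbf{V}$ if and only if $\mathbf{V}$ satisfies a regular expansion identity of some arity.
   Context: A profinite word over a finite alphabet $A$ is an element of the profinite completion of the free semigroup $A^+$; $|\rho| \in \mathbb{N}\cup\{\infty\}$ denotes the length of a profinite word $\rho$ and $c(\rho)$ its content, i.e. the set of letters occurring in it. An identity (pseudoidentity) is a pair $\rho_1 \approx \rho_2$ of nonempty profinite words over a finite alphabet of variables; it is nontrivial if $\rho_1 \neq \rho_2$. A finite semigroup $S$ satisfies the identity if $\rho_1$ and $\rho_2$ have the same image under every continuous homomorphism to $S$. A pseudovariety is a class of finite semigroups closed under finite direct products, subsemigroups and homomorphic images; it satisfies an identity if all its members do. $[\![\Delta]\!]$ denotes the pseudovariety of all finite semigroups satisfying all identities in $\Delta$; ''$\rho \approx 0$'' abbreviates the identities $u\rho \approx \rho$ and $\rho u \approx \rho$ with $u$ a new variable. An $n$-ary product identity is an identity of the form $x_1 \cdots x_n \approx \rho(x_1,\dots,x_n)$,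 where $x_1,\dots,x_n$ are distinct variables and $\rho$ is a nonempty profinite word in $x_1,\dots,x_n$ (not all of which need to occur in $\rho$). It is regular if $c(\rho) = \{x_1,\dots,x_n\}$, and it is an expansion identity if $|\rho| > n$. Put $\mathbf{T} = [\![xyx \approx x^2 \approx 0]\!]$, $\mathbf{U} = [\![xy \approx yx,\ x^2 \approx 0]\!]$, $\mathbf{N}_k = [\![x_1 \cdots x_k \approx 0]\!]$, $\mathbf{T}_k = \mathbf{T} \cap \mathbf{N}_k$ and $\mathbf{U}_k = \mathbf{U} \cap \mathbf{N}_k$. *)

(* Defs.v *)
From HB Require Import structures.
From mathcomp Require Import all_boot.
From mathcomp Require Import all_classical.
From mathcomp Require Import topology.

Set Implicit Arguments.
Unset Strict Implicit.
Unset Printing Implicit Defensive.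

Local Open Scope classical_set_scope.
Local Open Scope quotient_scope.
Local Open Scope group_scope.

(* By convention, semigroups are nonempty. *)
HB.mixin Record isInhabited T := { is_inhabited : inhabited T }.

#[short(type="finSemigroupType")]
HB.structure Definition FinSemigroup :=
  {S of Semigroup S & Finite S & isInhabited S}.

Section DirectProduct.
Variables (I : finType) (S : I -> finSemigroupType).

Definition dffun_mul (f g : {dffun forall i : I, S i}) :
  {dffun forall i : I, S i} := [ffun i => f i * g i].

Fact dffun_mulA : associative dffun_mul.
Proof. by move=> f g h; apply/ffunP => i; rewrite !ffunE mulgA. Qed.

HB.instance Definition _ := isSemigroup.Build {dffun forall i : I, S i} dffun_mulA.

Fact dffun_inhabited : inhabited {dffun forall i : I, S i}.
Proof.
have inh i : {x : S i | True}.
  by apply: cid; have [x] := @is_inhabited (S i); exists x.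
by split; exact: [ffun i => sval (inh i)].
Qed.

HB.instance Definition _ := isInhabited.Build {dffun forall i : I, S i} dffun_inhabited.
End DirectProduct.

(* Not [set finSemigroupType]: the universe of [set] is too small. *)
Definition semigroup_class := finSemigroupType -> Prop.

Definition subclass (V W : semigroup_class) : Prop := forall S, V S -> W S.

(* Subsemigroups are given up to isomorphism, by embeddings; the empty product
   is allowed, so that a pseudovariety contains the trivial semigroup. *)
Definition pseudovariety (V : semigroup_class) : Prop :=
  [/\ forall (I : finType) (S : I -> finSemigroupType),
        (forall i, V (S i)) -> V {dffun forall i : I, S i},
      forall (S T : finSemigroupType) (f : {multiplicative S -> T}),
        injective f -> V T -> V S
    & forall (S T : finSemigroupType) (f : {multiplicative S -> T}),
        (forall t, exists s, f s = t) -> V S -> V T].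

Record word (A : Type) := Word { letters :> seq A; _ : ~~ nilp letters }.

HB.instance Definition _ A := [isSub for @letters A].
HB.instance Definition _ (A : eqType) := [Equality of word A by <:].
HB.instance Definition _ (A : choiceType) := [Choice of word A by <:].

Fact letter_subproof (A : Type) (a : A) : ~~ nilp [:: a]. Proof. by []. Qed.
Definition letter (A : Type) (a : A) : word A := Word (letter_subproof a).

Fact word_mul_subproof (A : Type) (u v : word A) : ~~ nilp (letters u ++ letters v).
Proof. by case: u => -[]. Qed.
Definition word_mul (A : Type) (u v : word A) : word A := Word (word_mul_subproof u v).

Fact word_mulA (A : Type) : associative (@word_mul A).
Proof. by move=> u v w; apply: val_inj; rewrite /= catA. Qed.

HB.instance Definition _ (A : choiceType) := isSemigroup.Build (word A) (@word_mulA A).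

Fact word_map_subproof (A B : Type) (f : A -> B) (w : word A) :
  ~~ nilp (map f (letters w)).
Proof. by case: w => -[]. Qed.
Definition word_map (A B : Type) (f : A -> B) (w : word A) : word B :=
  Word (word_map_subproof f w).

Record congruence (A : finType) := Congruence {
  cong_rel :> equiv_rel (word A);
  congM : forall u u' v v' : word A,
    cong_rel u u' -> cong_rel v v' -> cong_rel (u * v) (u' * v');
  cong_finite_index : exists s : seq (word A), forall w, has (cong_rel w) s
}.

(* [tychonoff] requires an [eqType] of indices. *)
HB.instance Definition _ (A : finType) := gen_eqMixin (congruence A).

Section Quotient.
Variables (A : finType) (r : congruence A).

Definition quo : Type := {eq_quot (cong_rel r)}%qT.
HB.instance Definition _ := Choice.on quo.
HB.instance Definition _ := EqQuotient.on quo.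

Definition quo_mul (x y : quo) : quo := \pi_quo (repr x * repr y).

Fact quo_mul_pi u v : quo_mul (\pi_quo u) (\pi_quo v) = (\pi_quo (u * v)).
Proof. by apply/eqmodP/congM; apply/eqmodP; rewrite reprK. Qed.

Fact quo_mulA : associative quo_mul.
Proof.
move=> x y z; rewrite -[x]reprK -[y]reprK -[z]reprK.
rewrite (quo_mul_pi (repr y) (repr z)) (quo_mul_pi (repr x) (repr y)).
rewrite (quo_mul_pi (repr x) (repr y * repr z)).
by rewrite (quo_mul_pi (repr x * repr y) (repr z)) mulgA.
Qed.

HB.instance Definition _ := isSemigroup.Build quo quo_mulA.
End Quotient.

(* The inverse limit of the finite discrete quotients of [word A], as a
   subspace of their product: whenever [r] refines [r'], the transition map
   [quo r -> quo r'] sends [x r] to [x r']. *)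
Definition coherent (A : finType) :
    set (prod_topology (fun r : congruence A => discrete_topology (quo r))) :=
  [set x | forall r r' : congruence A,
    (forall u v, r u v -> r' u v) -> (\pi_(quo r') (repr (x r : quo r))) = x r'].

Definition profinite_word (A : finType) : Type := set_type (@coherent A).
HB.instance Definition _ (A : finType) := Topological.on (profinite_word A).

Definition Profinite (A : finType) (x : forall r : congruence A, quo r)
    (xP : coherent x) : profinite_word A :=
  exist (fun y => y \in coherent (A:=A)) x (mem_set xP).

Definition proj_quo (A : finType) (x : profinite_word A) (r : congruence A) :
  quo r := val x r.

Section ProfiniteSemigroup.
Variable A : finType.
Implicit Types x y z : profinite_word A.

Fact word_coherent (w : word A) : coherent (fun r => \pi_(quo r) w).
Proof.
move=> r r' rr' /=; apply/eqmodP/rr'.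
by apply/eqmodP; rewrite reprK.
Qed.
Definition of_word (w : word A) : profinite_word A :=
  Profinite (word_coherent w).

Fact profinite_mul_coherent x y :
  coherent (fun r => proj_quo x r * proj_quo y r).
Proof.
move=> r r' rr' /=.
have := set_mem (valP x) r r' rr'; have := set_mem (valP y) r r' rr'.
rewrite /proj_quo => <- <-; rewrite [RHS]quo_mul_pi; apply/eqmodP/rr'.
by apply/eqmodP; rewrite reprK.
Qed.
Definition profinite_mul x y : profinite_word A :=
  Profinite (profinite_mul_coherent x y).

Fact profinite_mulA : associative profinite_mul.
Proof.
move=> x y z; apply: val_inj; apply: functional_extensionality_dep => r /=.
by rewrite /proj_quo /= mulgA.
Qed.

HB.instance Definition _ := isSemigroup.Build (profinite_word A) profinite_mulA.
End ProfiniteSemigroup.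

(* [None] stands for infinity: the profinite words of finite length are exactly
   the elements of the free semigroup. *)
Definition profinite_length (A : finType) (x : profinite_word A) : option nat :=
  if pselect (exists w, x = of_word w) is left xw
  then Some (size (letters (sval (cid xw)))) else None.

Definition longer_than (A : finType) (n : nat) (x : profinite_word A) : Prop :=
  if profinite_length x is Some l then n < l else True.

(* The content of a profinite word is given by the continuous extension of
   [word_content]; as the latter has a finite range, it factors through the
   quotient by its kernel. *)
Section Content.
Variable A : finType.

Definition word_content (w : word A) : {set A} := [set a in letters w]%SET.

Definition same_content (u v : word A) := word_content u == word_content v.

Fact same_content_equiv : equiv_class_of same_content.
Proof.
apply: EquivClass => [u|u v|v u w]; rewrite /same_content => //.
by move=> /eqP-> /eqP->.
Qed.

Fact same_contentM (u u' v v' : word A) :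
  same_content u u' -> same_content v v' -> same_content (u * v) (u' * v').
Proof.
have contentM x y :
    word_content (x * y) = (word_content x :|: word_content y)%SET.
  by apply/setP => a; rewrite !inE mem_cat.
by rewrite /same_content !contentM => /eqP-> /eqP->.
Qed.

Fact same_content_finite_index :
  exists s : seq (word A), forall w, has (same_content w) s.
Proof.
pose f (B : {set A}) : seq (word A) :=
  if pselect (exists w, word_content w = B) is left e then [:: sval (cid e)]
  else [::].
exists (flatten [seq f B | B <- enum {set A}]) => w.
apply/hasP; case fE : (f (word_content w)) => [|v s].
  by move: fE; rewrite /f; case: pselect => // -[]; exists w.
exists v; first by apply/flattenP; exists (f (word_content w));
  [exact: map_f (mem_enum _ _) | rewrite fE mem_head].
move: fE; rewrite /f; case: pselect => // e [<- _]; rewrite /same_content.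
by case: cid => u /= ->.
Qed.

Definition content_congruence : congruence A :=
  @Congruence A (EquivRelPack same_content_equiv) same_contentM
    same_content_finite_index.

Definition content (x : profinite_word A) : {set A} :=
  word_content (repr (proj_quo x content_congruence)).

Lemma content_of_word (w : word A) : content (of_word w) = word_content w.
Proof.
apply/eqP; rewrite -/(same_content _ _).
by apply/(@eqmodP _ content_congruence); rewrite reprK.
Qed.
End Content.

Record identity := Identity {
  variables : finType;
  lhs : profinite_word variables;
  rhs : profinite_word variables
}.
Arguments Identity {variables} lhs rhs.

Definition satisfies (S : finSemigroupType) (e : identity) : Prop :=
  forall h : {multiplicative profinite_word (variables e) -> S},
    continuous (h : profinite_word (variables e) -> discrete_topology S) ->
    h (lhs e) = h (rhs e).

Definition class_satisfies (V : semigroup_class) (e : identity) : Prop :=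
  forall S, V S -> satisfies S e.

Definition models (D : identity -> Prop) : semigroup_class :=
  fun S => forall e, D e -> satisfies S e.

Definition word_identity (A : finType) (u v : word A) : identity :=
  Identity (of_word u) (of_word v).

(* The identities [u w = w] and [w u = w], where the new variable [u] is [None]. *)
Definition vanishing (A : finType) (w : word A) : identity -> Prop :=
  let u : word (option A) := letter None in
  let w' : word (option A) := word_map some w in
  fun e => e = word_identity (u * w') w' \/ e = word_identity (w' * u) w'.

(* The word [x_1 ... x_n]; positivity of [n] makes it nonempty. *)
Fact prod_word_subproof (n : nat) (n_gt0 : 0 < n) : ~~ nilp (enum 'I_n).
Proof. by rewrite /nilp size_enum_ord -lt0n. Qed.
Definition prod_word (n : nat) (n_gt0 : 0 < n) : word 'I_n :=
  Word (prod_word_subproof n_gt0).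

Definition product_identity (n : nat) (n_gt0 : 0 < n)
  (rho : profinite_word 'I_n) : identity :=
  Identity (of_word (prod_word n_gt0)) rho.

Definition nontrivial (e : identity) : Prop := lhs e <> rhs e.

Definition regular (n : nat) (rho : profinite_word 'I_n) : Prop :=
  content rho = [set: 'I_n]%SET.

Section Pseudovarieties.
Let x : word 'I_2 := letter ord0.
Let y : word 'I_2 := letter ord_max.

Definition pvT : semigroup_class :=
  models (fun e => e = word_identity (x * y * x) (x * x) \/ vanishing (x * x) e).

Definition pvU : semigroup_class :=
  models (fun e => e = word_identity (x * y) (y * x) \/ vanishing (x * x) e).
End Pseudovarieties.

Definition pvN (k : nat) (k_gt0 : 0 < k) : semigroup_class :=
  models (vanishing (prod_word k_gt0)).

Definition pvT_ (k : nat) (k_gt0 : 0 < k) : semigroup_class :=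
  fun S => pvT S /\ pvN k_gt0 S.

Definition pvU_ (k : nat) (k_gt0 : 0 < k) : semigroup_class :=
  fun S => pvU S /\ pvN k_gt0 S.

(* Main.v *)
(* Words with a repeated letter or of length greater than [k] are zero in every
   member of [T_(k+1)], so [T_(k+1)] is contained in [V] as soon as [V] separates
   each word [w] of length at most [k] without repeated letters from all other
   words.  By a substitution that splits [x_1 ... x_k] into [|w|] pieces and sends
   the remaining letters to words with a repeated letter, it is enough to separate
   [x_1 ... x_k].  If no member of [V] does this, then, by compactness, [V]
   satisfies some [x_1 ... x_k = rho] with [rho] distinct from [x_1 ... x_k].
   Conversely, the factors of [x_1 ... x_k], together with a zero, form a member
   of [T_(k+1)] that violates every nontrivial [k]-ary product identity.

   For [U_(k+1)], words are considered up to permutation of the letters, and the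
   nonempty sets of variables under disjoint union replace the factors.  If
   [x_1 ... x_k = rho] holds and [x_i] does not occur in [rho], then substituting
   [x_i^2] for [x_i] yields the regular expansion identity
   [x_1 ... x_k = x_1 ... x_i^2 ... x_k]. *)

From HB Require Import structures.
Require Import Defs.
From mathcomp Require Import all_boot.
From mathcomp Require Import all_classical.
From mathcomp Require Import topology.

Set Implicit Arguments.
Unset Strict Implicit.
Unset Printing Implicit Defensive.

Local Open Scope classical_set_scope.
Local Open Scope quotient_scope.
Local Open Scope group_scope.

(** * Words and congruences *)

Lemma word_ind (A : choiceType) (P : word A -> Prop) :
  (forall a, P (letter a)) -> (forall a w, P w -> P (letter a * w)) ->
  forall w, P w.
Proof.
move=> P1 PM [s]; elim: s => // a [_ s0|b s IHs s0].
  by have -> : Word s0 = letter a by exact: val_inj.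
have -> : Word s0 = letter a * Word (isT : ~~ nilp (b :: s)) by exact: val_inj.
exact/PM/IHs.
Qed.

Section Eval.
Variables (A : choiceType) (S : semigroupType) (f : A -> S).

(** The fold starts at the value of the first letter, since [S] need not have a unit. *)
Definition eval (w : word A) : S :=
  let: Word s s0 := w in
  match s return ~~ nilp s -> S with
  | [::] => fun s0 => False_rect S (elimN idP s0 isT)
  | a :: s => fun=> foldl (fun x b => x * f b) (f a) s
  end s0.

Lemma eval_letter a : eval (letter a) = f a. Proof. by []. Qed.

Fact evalM : {morph eval : u v / u * v}.
Proof.
move=> [[//|a u] u0] [[//|b v] v0] /=; rewrite foldl_cat /=.
set x := foldl _ _ u; elim/last_ind: v {v0} => //= v c IHv.
by rewrite !foldl_rcons IHv mulgA.
Qed.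

HB.instance Definition _ := isMultiplicative.Build (word A) S eval evalM.
End Eval.
Arguments eval : simpl never.

Lemma hom_eval (A : choiceType) (S : semigroupType)
    (h : {multiplicative word A -> S}) w :
  h w = eval (fun a => h (letter a)) w.
Proof. by elim/word_ind: w => // a w IHw; rewrite gmulfM evalM -IHw. Qed.

Lemma eval_word_map (A B : choiceType) (S : semigroupType) (f : B -> S)
    (g : A -> B) w : eval f (word_map g w) = eval (f \o g) w.
Proof.
elim/word_ind: w => // a w IHw; rewrite evalM -IHw.
have -> : word_map g (letter a * w) = letter (g a) * word_map g w by exact: val_inj.
by rewrite evalM.
Qed.

Lemma letters_eval (A B : choiceType) (f : A -> word B) w :
  letters (eval f w) = flatten [seq letters (f a) | a <- letters w].
Proof. by elim/word_ind: w => [a|a w IHw]; rewrite ?evalM /= ?IHw ?cats0. Qed.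

(** One representative is taken from each nonempty fibre of [f]; the fibres are finitely many, and
    each lies in a single class of [r]. *)
Lemma finite_index_of (A : finType) (F : finType) (f : word A -> F)
    (r : equiv_rel (word A)) :
  (forall u v, f u = f v -> r u v) ->
  exists s : seq (word A), forall w, has (r w) s.
Proof.
move=> fr; pose g (y : F) : seq (word A) :=
  if pselect (exists w, f w = y) is left e then [:: sval (cid e)] else [::].
exists (flatten [seq g y | y <- enum F]) => w; apply/hasP.
case gE : (g (f w)) => [|v s].
  by move: gE; rewrite /g; case: pselect => // -[]; exists w.
exists v; first by apply/flattenP; exists (g (f w));
  [exact: map_f (mem_enum _ _) | rewrite gE mem_head].
move: gE; rewrite /g; case: pselect => // e [<- _].
by case: cid => u /= uw; exact: fr.
Qed.

Section Kernel.
Variables (A : finType) (S : finSemigroupType) (h : {multiplicative word A -> S}).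

Definition kernel (u v : word A) := h u == h v.

Fact kernel_equiv : equiv_class_of kernel.
Proof.
apply: EquivClass => [u|u v|v u w]; rewrite /kernel => //.
by move=> /eqP-> /eqP->.
Qed.

Fact kernelM u u' v v' : kernel u u' -> kernel v v' -> kernel (u * v) (u' * v').
Proof. by rewrite /kernel !gmulfM => /eqP-> /eqP->. Qed.

Definition kernel_congruence : congruence A :=
  @Congruence A (EquivRelPack kernel_equiv) kernelM
    (@finite_index_of A S h (EquivRelPack kernel_equiv) (fun u v => introT eqP)).
End Kernel.

Section LengthCongruence.
Variables (A : finType) (n : nat).

(** All words longer than [n] share the value [None], so the kernel is the Rees congruence of the
    ideal they form; shorter words are alone in their classes. *)
Definition bounded_word (w : word A) : option (n.-bseq A) := insub (letters w).

Definition same_bounded (u v : word A) := bounded_word u == bounded_word v.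

Lemma same_boundedP (u v : word A) :
  reflect (u = v \/ n < size (letters u) /\ n < size (letters v)) (same_bounded u v).
Proof.
rewrite /same_bounded /bounded_word; apply: (iffP eqP) => [|[->//|[un vn]]]; last first.
  by rewrite !insubN // -ltnNge.
case: insubP => [s un su|]; case: insubP => [t vn tv|] //.
- by move=> [st]; left; apply: val_inj; rewrite /= -su -tv st.
- by rewrite -!ltnNge; right.
Qed.

Fact same_bounded_equiv : equiv_class_of same_bounded.
Proof.
apply: EquivClass => [u|u v|v u w]; rewrite /same_bounded => //.
by move=> /eqP-> /eqP->.
Qed.

Fact same_boundedM u u' v v' :
  same_bounded u u' -> same_bounded v v' -> same_bounded (u * v) (u' * v').
Proof.
move=> /same_boundedP uu' /same_boundedP vv'; apply/same_boundedP.
case: uu' vv' => [->|[un u'n]] [->|[vn v'n]]; first by left.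
all: right; rewrite /= !size_cat.
all: by rewrite ?(ltn_addl _ vn) ?(ltn_addl _ v'n) ?(ltn_addr _ un) ?(ltn_addr _ u'n).
Qed.

Definition length_congruence : congruence A :=
  @Congruence A (EquivRelPack same_bounded_equiv) same_boundedM
    (@finite_index_of A _ bounded_word (EquivRelPack same_bounded_equiv)
       (fun u v => introT eqP)).
End LengthCongruence.

Section Meet.
Variables (A : finType) (r1 r2 : congruence A).

Definition meet_rel (u v : word A) := r1 u v && r2 u v.

Fact meet_rel_equiv : equiv_class_of meet_rel.
Proof.
apply: EquivClass => [u|u v|v u w]; rewrite /meet_rel.
- by rewrite !equiv_refl.
- by rewrite equiv_sym [r2 _ _]equiv_sym.
- by move=> /andP[uv1 uv2]; rewrite (equiv_ltrans uv1) (equiv_ltrans uv2).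
Qed.

Fact meet_relM u u' v v' :
  meet_rel u u' -> meet_rel v v' -> meet_rel (u * v) (u' * v').
Proof. by move=> /andP[? ?] /andP[? ?]; apply/andP; split; exact: congM. Qed.

Fact meet_rel_finite_index : exists s : seq (word A), forall w, has (meet_rel w) s.
Proof.
have [s1 s1P] := cong_finite_index r1; have [s2 s2P] := cong_finite_index r2.
(* The position of the first representative related to [w] determines the class of [w]. *)
pose f w : 'I_(size s1).+1 * 'I_(size s2).+1 :=
  (inord (find (r1 w) s1), inord (find (r2 w) s2)).
apply: (@finite_index_of A _ f (EquivRelPack meet_rel_equiv)) => u v.
have ltf (r : congruence A) s w : find (r w) s < (size s).+1 by rewrite ltnS find_size.
have fr (r : congruence A) s : (forall w, has (r w) s) ->
    find (r u) s = find (r v) s -> r u v.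
  move=> sP uv; have := nth_find u (sP u); have := nth_find u (sP v).
  by rewrite uv [r v _]equiv_sym => vs us; exact: equiv_trans us vs.
case=> /(congr1 val) /= uv1 /(congr1 val) /= uv2.
move: uv1 uv2; rewrite !inordK // => uv1 uv2.
by apply/andP; split; apply: fr; eauto.
Qed.

Definition meet_congruence : congruence A :=
  @Congruence A (EquivRelPack meet_rel_equiv) meet_relM meet_rel_finite_index.
End Meet.

(** * Profinite words and their approximations *)

Section Approximation.
Variable A : finType.
Implicit Types (x : profinite_word A) (r : congruence A) (w : word A).

(** Profinite words are handled through finite words that represent them in one finite quotient at a
    time. *)
Definition approx r x w : Prop := proj_quo x r = \pi_(quo r) w.

Lemma approx_repr r x : approx r x (repr (proj_quo x r)).
Proof. by rewrite /approx reprK. Qed.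

Lemma approx_of_word r w : approx r (of_word w) w.
Proof. by []. Qed.

Lemma approx_cong r x u v : approx r x u -> approx r x v <-> r u v.
Proof.
move=> xu; rewrite /approx xu; split => [uv|uv]; first exact/eqmodP.
exact/eqmodP.
Qed.

Lemma approx_refine r r' x w :
  (forall u v, r u v -> r' u v) -> approx r x w -> approx r' x w.
Proof.
move=> rr' xw; rewrite /approx.
have <- : \pi_(quo r') (repr (proj_quo x r)) = proj_quo x r'.
  exact: (set_mem (valP x) r r' rr').
by rewrite xw; apply/eqmodP/rr'; apply/eqmodP; rewrite reprK.
Qed.

Lemma approxM r x y u v : approx r x u -> approx r y v -> approx r (x * y) (u * v).
Proof.
move=> xu yv; rewrite /approx.
have -> : proj_quo (x * y) r = quo_mul (proj_quo x r) (proj_quo y r) by [].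
by rewrite xu yv; exact: quo_mul_pi.
Qed.

Lemma approx_both r1 r2 x : exists w, approx r1 x w /\ approx r2 x w.
Proof.
exists (repr (proj_quo x (meet_congruence r1 r2))).
by split; apply: approx_refine (approx_repr _ _) => u v /andP[].
Qed.

Lemma profinite_eq x y :
  (forall r, exists w, approx r x w /\ approx r y w) -> x = y.
Proof.
move=> xy; apply: val_inj; apply: functional_extensionality_dep => r.
by have [w [xw yw]] := xy r; rewrite -[LHS]/(proj_quo x r) xw -yw.
Qed.

(** A common representative of [x] for [r] and any other congruence lies in the class of [w], hence
    is [w]; so [x] and [w] agree in every quotient. *)
Lemma isolated_word r x w :
  (forall u, r w u -> u = w) -> approx r x w -> x = of_word w.
Proof.
move=> rw xw; apply: profinite_eq => r'.
have [u [xu xu']] := approx_both r r' x; exists u; split => //.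
by rewrite (rw u) //; apply/(approx_cong _ xw).
Qed.

Lemma of_word_approx n w u :
  size (letters w) <= n -> approx (length_congruence A n) (of_word w) u -> u = w.
Proof.
by move=> wn /(approx_cong _ (approx_of_word _ w))/same_boundedP[//|[]]; rewrite ltnNge wn.
Qed.

(** By [isolated_word], a profinite word with a representative of length at most [n] is that finite
    word; one of infinite length has only longer representatives. *)
Lemma longer_thanP n x :
  longer_than n x <-> exists2 w, approx (length_congruence A n) x w & n < size (letters w).
Proof.
rewrite /longer_than /profinite_length; case: pselect => [e|ne]; last first.
  split=> // _; exists (repr (proj_quo x (length_congruence A n))).
    exact: approx_repr.
  rewrite ltnNge; apply/negP => wn; apply: ne; eexists.
  apply: isolated_word (approx_repr (length_congruence A n) x) => u.
  by move=> /same_boundedP[//|[]]; rewrite ltnNge wn.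
case: cid => w /= {e}->; split=> [wn|[u /(approx_cong _ (approx_of_word _ w))]].
  by exists w.
by move=> /same_boundedP[->|[]].
Qed.

Section Extension.
Variables (S : finSemigroupType) (h : {multiplicative word A -> S}).

(** The continuous extension of [h], factored through the finite quotient by the kernel of [h]. *)
Definition extend x : S := h (repr (proj_quo x (kernel_congruence h))).

Lemma extendE x w : approx (kernel_congruence h) x w -> extend x = h w.
Proof. by move/(approx_cong _ (approx_repr _ x))/eqP. Qed.

Lemma extend_of_word w : extend (of_word w) = h w.
Proof. exact: extendE. Qed.

Fact extendM : {morph extend : x y / x * y}.
Proof.
move=> x y; rewrite (extendE (approxM (approx_repr _ x) (approx_repr _ y))).
by rewrite gmulfM.
Qed.

HB.instance Definition _ := isMultiplicative.Build (profinite_word A) S extend extendM.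

Lemma extend_continuous : continuous (extend : profinite_word A -> discrete_topology S).
Proof.
move=> x; apply/discrete_cvg; first exact/fmap_filter/nbhs_filter.
pose r := kernel_congruence h.
pose K := prod_topology (fun r : congruence A => discrete_topology (quo r)).
have cvgr : @^~ r @ (nbhs (val x : K)) --> (val x r : discrete_topology (quo r)).
  exact: (@proj_continuous _ (fun r => discrete_topology (quo r)) r (val x)).
have : nbhs x [set y | proj_quo y r = proj_quo x r].
  have cvgv := @initial_continuous _ _ (val : profinite_word A -> K) x.
  exact: (cvgv _ (cvgr _ (discrete_set1 (val x r : discrete_topology (quo r))))).
by apply: filterS => y /= yx; rewrite /extend -/r yx.
Qed.
End Extension.

(** The representatives of [x] modulo [r], as [r] varies, form a filter base because congruences
    have meets; each coordinate is eventually constant along it. *)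
Lemma dense_words x : exists2 F : set_system (word A),
  ProperFilter F & @of_word A @ F --> x.
Proof.
pose K := prod_topology (fun r : congruence A => discrete_topology (quo r)).
pose F := filter_from setT (fun r => [set w | approx r x w]).
have FF : Filter F.
  apply: filter_from_filter => [|r1 r2 _ _]; first by exists (length_congruence A 0).
  exists (meet_congruence r1 r2) => // w xw.
  by split; apply: approx_refine xw => u v /andP[].
have PF : ProperFilter F.
  by apply: filter_from_proper => r _; exists (repr (proj_quo x r)); exact: approx_repr.
exists F => //.
have cvgv : (fun w => val (of_word w) : K) @ F --> (val x : K).
  apply/cvg_sup => r U [_ [[B _ <-] Bx BU]].
  exists r => // w xw; apply: BU; move: Bx; rewrite /= -[val x r]/(proj_quo x r).
  by rewrite xw.
move=> U [_ [[B oB <-] Bx BU]]; have nB : nbhs (val x : K) B by exact: open_nbhs_nbhs.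
by have [r _ rB] := cvgv B nB; exists r => // w /rB Bw; exact: BU.
Qed.

(** Two continuous maps to a discrete space that agree on the dense set of finite words are equal:
    near [x], both take their values at [x] on a common finite word. *)
Lemma continuous_hom_extend (S : finSemigroupType)
    (h : {multiplicative profinite_word A -> S})
    (h' : {multiplicative word A -> S}) :
  (forall w, h' w = h (of_word w)) ->
  continuous (h : profinite_word A -> discrete_topology S) -> h =1 extend h'.
Proof.
move=> hh' hc x; have [F PF Fx] := dense_words x.
have hF : F [set w | h (of_word w) = h x].
  exact: (Fx _ (hc x _ (@discrete_set1 (discrete_topology S) (h x)))).
have h'F : F [set w | extend h' (of_word w) = extend h' x].
  exact: (Fx _ (extend_continuous (@discrete_set1 (discrete_topology S) _))).
have [w [/= <- <-]] := filter_ex (filterI hF h'F).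
by rewrite extend_of_word.
Qed.
End Approximation.

(** * Identities *)

(** Continuous homomorphisms are exactly the extensions of homomorphisms on finite words, so
    satisfaction can be tested without topology. *)
Lemma satisfies_wordP (S : finSemigroupType) (A : finType) (w : word A)
    (rho : profinite_word A) :
  satisfies S (Identity (of_word w) rho) <->
  forall h : {multiplicative word A -> S}, h w = extend h rho.
Proof.
split=> [Srho h|Srho h hc].
  by have /= := Srho (extend h) (@extend_continuous _ _ h); rewrite extend_of_word.
have hM : {morph (h \o @of_word A) : u v / u * v}.
  move=> u v /=; rewrite -gmulfM; congr (h _); apply: profinite_eq => r.
  exists (u * v); split=> //.
  by apply: (@approxM _ _ (of_word u) (of_word v)).
pose m := isMultiplicative.Build _ _ (h \o @of_word A) hM.
pose h' : {multiplicative word A -> S} := HB.pack (h \o @of_word A) m.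
by rewrite /= [RHS](continuous_hom_extend (h' := h')) // -(Srho h').
Qed.

Lemma satisfies_word_identity (S : finSemigroupType) (A : finType) (u v : word A) :
  satisfies S (word_identity u v) <->
  forall h : {multiplicative word A -> S}, h u = h v.
Proof.
by split=> [/satisfies_wordP Suv h|Suv]; [|apply/satisfies_wordP => h];
  rewrite ?Suv extend_of_word.
Qed.

Definition is_zero (S : semigroupType) (z : S) : Prop :=
  forall x, x * z = z /\ z * x = z.

Lemma is_zero_uniq (S : semigroupType) (y z : S) : is_zero y -> is_zero z -> y = z.
Proof. by move=> y0 z0; have [_ <-] := y0 z; have [->] := z0 y. Qed.

Lemma is_zeroMl (S : semigroupType) (x z : S) : is_zero z -> is_zero (x * z).
Proof. by move=> z0; have [-> _] := z0 x. Qed.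

Lemma is_zeroMr (S : semigroupType) (x z : S) : is_zero z -> is_zero (z * x).
Proof. by move=> z0; have [_ ->] := z0 x. Qed.

Lemma satisfies_vanishing (S : finSemigroupType) (A : finType) (w : word A) :
  models (vanishing w) S <->
  forall h : {multiplicative word A -> S}, is_zero (h w).
Proof.
split=> [Sw h x|Sw e].
  (* The new variable is sent to the element against which the zero is tested. *)
  pose f (o : option A) := if o is Some a then h (letter a) else x.
  have fw : eval f (word_map some w) = h w by rewrite eval_word_map [RHS]hom_eval.
  have /satisfies_word_identity/(_ (eval f)) := Sw _ (or_introl erefl).
  have /satisfies_word_identity/(_ (eval f)) := Sw _ (or_intror erefl).
  by rewrite !gmulfM /= fw eval_letter.
have Sh (h : {multiplicative word (option A) -> S}) : is_zero (h (word_map some w)).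
  by rewrite hom_eval eval_word_map; exact: Sw.
by case=> ->; apply/satisfies_word_identity => h; rewrite gmulfM;
  have [] := Sh h (h (letter None)).
Qed.

Lemma pvTP (S : finSemigroupType) :
  pvT S <-> (forall x y : S, x * y * x = x * x) /\ (forall x : S, is_zero (x * x)).
Proof.
split=> [ST|[S1 S2] e].
  split=> [x y|x].
    have /satisfies_word_identity/(_ (eval (fun i => if i == ord0 then x else y))) :=
      ST _ (or_introl erefl).
    by rewrite !gmulfM.
  have /satisfies_vanishing/(_ (eval (fun=> x))) : models (vanishing
    (letter (ord0 : 'I_2) * letter (ord0 : 'I_2))) S by move=> e ex; apply: ST; right.
  by rewrite gmulfM.
case=> [->|]; first by apply/satisfies_word_identity => h; rewrite !gmulfM.
by apply/satisfies_vanishing: e => h; rewrite gmulfM.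
Qed.

Lemma pvUP (S : finSemigroupType) :
  pvU S <-> (forall x y : S, x * y = y * x) /\ (forall x : S, is_zero (x * x)).
Proof.
split=> [SU|[S1 S2] e].
  split=> [x y|x].
    have /satisfies_word_identity/(_ (eval (fun i => if i == ord0 then x else y))) :=
      SU _ (or_introl erefl).
    by rewrite !gmulfM.
  have /satisfies_vanishing/(_ (eval (fun=> x))) : models (vanishing
    (letter (ord0 : 'I_2) * letter (ord0 : 'I_2))) S by move=> e ex; apply: SU; right.
  by rewrite gmulfM.
case=> [->|]; first by apply/satisfies_word_identity => h; rewrite !gmulfM.
by apply/satisfies_vanishing: e => h; rewrite gmulfM.
Qed.

Lemma pvU_pvT : subclass pvU pvT.
Proof.
move=> S /pvUP[SC S0]; apply/pvTP; split=> // x y.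
by rewrite [x * y]SC -mulgA; have [->] := S0 x y.
Qed.

(** The first [n] letters of [u] form a value of the word [x_1 ... x_n], and the resulting zero
    absorbs the rest. *)
Lemma pvNP (n : nat) (n_gt0 : 0 < n) (S : finSemigroupType) :
  pvN n_gt0 S <-> forall u : word S, size (letters u) >= n -> is_zero (eval id u).
Proof.
split=> [/satisfies_vanishing SN u nu|SN]; last first.
  apply/satisfies_vanishing => h; rewrite hom_eval -(eval_word_map id).
  by apply: SN; rewrite /= size_map size_enum_ord.
case: u nu => -[//|a s] s0 /= ns.
pose f (i : 'I_n) := nth a (a :: s) i.
have fE : map f (enum 'I_n) = take n (a :: s).
  apply: (@eq_from_nth _ a) => [|i]; rewrite size_map size_enum_ord.
    by rewrite size_takel.
  move=> i_n; rewrite (nth_map (Ordinal i_n)) ?size_enum_ord // /f nth_enum_ord //.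
  by rewrite nth_take.
have : is_zero (eval id (word_map f (prod_word n_gt0))).
  by rewrite eval_word_map; exact: (SN (eval f)).
have := cat_take_drop n (a :: s); rewrite -fE.
case: (drop n (a :: s)) => [|b t] E.
  have -> // : Word s0 = word_map f (prod_word n_gt0).
  by apply: val_inj; rewrite /= -E cats0.
have -> : Word s0 = word_map f (prod_word n_gt0) * (Word (isT : ~~ nilp (b :: t))).
  by apply: val_inj; rewrite /= -E.
by rewrite evalM; exact: is_zeroMr.
Qed.

Section RepeatedLetter.
Variables (S : finSemigroupType) (ST : pvT S).

(** The letters of [w] before an occurrence of [a] are absorbed into [x], which is why [x] is
    arbitrary; then [a * x * a] is the zero [a * a]. *)
Lemma zero_factor (w : word S) (a x : S) :
  a \in letters w -> is_zero (a * x * eval id w).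
Proof.
move/pvTP: ST => [S1 S2]; elim/word_ind: w x => [b|b w IHw] x /=.
  by rewrite inE => /eqP <-; rewrite S1.
rewrite inE evalM mulgA => /predU1P[<-|aw]; first by rewrite S1; exact: is_zeroMr.
by rewrite -(mulgA a); exact: IHw.
Qed.

Lemma zero_not_uniq (w : word S) : ~~ uniq (letters w) -> is_zero (eval id w).
Proof.
move/pvTP: (ST) => [S1 S2]; elim/word_ind: w => [//|a w IHw] /=.
rewrite negb_and negbK evalM => /orP[|/IHw]; last exact: is_zeroMl.
elim/word_ind: w {IHw} => [b|b w _]; first by rewrite inE => /eqP<-.
rewrite inE evalM mulgA => /predU1P[->|aw]; first exact: is_zeroMr.
exact: zero_factor.
Qed.

(** Pigeonhole: a word with more than [#|S|] letters from [S] repeats one. *)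
Lemma pvT_nilpotent : pvN (ltn0Sn #|S|) S.
Proof.
apply/pvNP => u Su; apply: zero_not_uniq; apply/negP => /card_uniqP uu.
by have := max_card (mem (letters u)); rewrite uu leqNgt Su.
Qed.
End RepeatedLetter.

Lemma eval_perm (S : finSemigroupType) (u v : word S) :
  commutative (@mul S) -> perm_eq (letters u) (letters v) -> eval id u = eval id v.
Proof.
(* Adjoining [None] as a unit makes the commutative law available to big operators. *)
move=> SC uv; pose op := @oAC S *%g (@mulgA S) SC.
have opE w : \big[op/None]_(x <- letters w) Some x = Some (eval id w).
  elim/word_ind: w => [a|a w IHw]; first by rewrite big_seq1.
  by rewrite /= big_cons IHw evalM /op oACE.
by apply: Some_inj; rewrite -!opE; exact: perm_big.
Qed.

(** * Recognition and compactness *)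

Section Image.
Variables (A : choiceType) (S : finSemigroupType) (h : {multiplicative word A -> S}).

Definition image := {x : S | `[< exists w, h w = x >]}.

HB.instance Definition _ := Finite.on image.

Fact image_mul_subproof (x y : image) : `[< exists w, h w = val x * val y >].
Proof.
have [/asboolP[u <-] /asboolP[v <-]] := (valP x, valP y).
by apply/asboolP; exists (u * v); rewrite gmulfM.
Qed.
Definition image_mul (x y : image) : image :=
  exist (fun x => `[< exists w, h w = x >]) _ (image_mul_subproof x y).

Fact image_mulA : associative image_mul.
Proof. by move=> x y z; apply: val_inj; rewrite /= mulgA. Qed.

HB.instance Definition _ := isSemigroup.Build image image_mulA.

Fact image_of_subproof w : `[< exists w', h w' = h w >].
Proof. by apply/asboolP; exists w. Qed.
Definition image_of w : image :=
  exist (fun x => `[< exists w, h w = x >]) _ (image_of_subproof w).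

Lemma image_ofP (x : image) : exists w, x = image_of w.
Proof. by have /asboolP[w wx] := valP x; exists w; exact: val_inj. Qed.

Fact image_valM : {morph (val : image -> S) : x y / x * y}.
Proof. by []. Qed.
End Image.

(** The relation [R] need not be an equivalence: with [R u v] of the form [v = w -> u = w], for
    instance, this says that [V] separates [w] from all other words. *)
Definition recognizes (V : semigroup_class) (A : choiceType)
    (R : word A -> word A -> Prop) : Prop :=
  exists (S : finSemigroupType) (h : {multiplicative word A -> S}),
    V S /\ forall u v, h u = h v -> R u v.

Section Recognition.
Variables (V : semigroup_class) (V_pseudovariety : pseudovariety V).

Lemma recognizes_meet (A : choiceType) (I : finType)
    (R : I -> word A -> word A -> Prop) :
  (forall i, recognizes V (R i)) -> recognizes V (fun u v => forall i, R i u v).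
Proof.
move=> VR; have [VP _ _] := V_pseudovariety.
pose S i := projT1 (cid (VR i)).
have Sh i : exists h : {multiplicative word A -> S i},
    V (S i) /\ forall u v, h u = h v -> R i u v := projT2 (cid (VR i)).
pose h i := projT1 (cid (Sh i)).
have hP i : V (S i) /\ forall u v, h i u = h i v -> R i u v := projT2 (cid (Sh i)).
pose H (w : word A) : {dffun forall i, S i} := [ffun i => h i w].
have HM : {morph H : u v / u * v}.
  by move=> u v; apply/ffunP => i; rewrite !ffunE gmulfM.
pose m := isMultiplicative.Build _ _ H HM.
pose H' : {multiplicative word A -> {dffun forall i, S i}} := HB.pack H m.
exists {dffun forall i, S i}, H'; split=> [|u v /ffunP uv i].
  by apply: VP => i; have [] := hP i.
by have [_] := hP i; apply; have := uv i; rewrite !ffunE.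
Qed.

Lemma recognizes_true (A : choiceType) : recognizes V (fun _ _ : word A => True).
Proof.
have [|S [h [VS _]]] := @recognizes_meet A 'I_0 (fun=> fun _ _ => True); first by case.
by exists S, h.
Qed.

Lemma recognizes_and (A : choiceType) (R1 R2 : word A -> word A -> Prop) :
  recognizes V R1 -> recognizes V R2 -> recognizes V (fun u v => R1 u v /\ R2 u v).
Proof.
move=> VR1 VR2.
have [|S [h [VS hR]]] := @recognizes_meet A bool (fun b => if b then R1 else R2).
  by case.
by exists S, h; split=> // u v /hR uv; split; [exact: (uv true) | exact: (uv false)].
Qed.

Lemma recognizes_subst (A B : choiceType) (f : {multiplicative word A -> word B})
    (R : word B -> word B -> Prop) :
  recognizes V R -> recognizes V (fun u v => R (f u) (f v)).
Proof. by case=> S [h [VS hR]]; exists S, (h \o f); split=> // u v /hR. Qed.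

Lemma recognizes_sub (A : choiceType) (R R' : word A -> word A -> Prop) :
  (forall u v, R u v -> R' u v) -> recognizes V R -> recognizes V R'.
Proof. by move=> RR' [S [h [VS hR]]]; exists S, h; split=> // u v /hR/RR'. Qed.

(** The kernel of [h] refines that of evaluation, so [T] is a quotient of the image of [h], which is
    a subsemigroup of a member of [V]. *)
Lemma recognizes_eval (T : finSemigroupType) :
  recognizes V (fun u v : word T => eval id u = eval id v) -> V T.
Proof.
case=> S [h [VS hR]]; have [_ Vsub Vquo] := V_pseudovariety.
have inh : inhabited (image h).
  by have [t] := @is_inhabited T; split; exact: (image_of h (letter t)).
pose mi := isInhabited.Build (image h) inh.
pose Im : finSemigroupType := HB.pack (image h) mi.
pose mv := isMultiplicative.Build Im S (val : image h -> S) (@image_valM _ _ h).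
pose fv : {multiplicative Im -> S} := HB.pack (val : image h -> S) mv.
pose g (x : Im) : T := eval id (sval (cid (image_ofP x))).
have gE w : g (image_of h w) = eval id w.
  by rewrite /g; case: cid => u /= /(congr1 val) /= /hR.
have gM : {morph g : x y / x * y}.
  move=> x y; have [u ->] := image_ofP x; have [v ->] := image_ofP y.
  have -> : (image_of h u : Im) * image_of h v = image_of h (u * v).
    by apply: val_inj; rewrite /= gmulfM.
  by rewrite !gE evalM.
pose mg := isMultiplicative.Build Im T g gM.
pose g' : {multiplicative Im -> T} := HB.pack g mg.
apply: (Vquo Im T g').
  by move=> t; exists (image_of h (letter t)); rewrite /= gE eval_letter.
exact: (Vsub Im S fv val_inj VS).
Qed.

(* An ultrafilter on the words that satisfy [P] and that [V] does not separate
   from [w0] contains exactly one class of each congruence; these classes form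
   [rho]. *)
Lemma compactness (A : finType) (w0 : word A) (P : word A -> Prop) :
  ~ recognizes V (fun u v => v = w0 -> ~ P u) ->
  exists rho : profinite_word A,
    (forall r, exists w, P w /\ approx r rho w) /\
    class_satisfies V (Identity (of_word w0) rho).
Proof.
(* A set [E] belongs to [F] when some member of [V] separates [w0] from all words of [P] outside
   [E]; the hypothesis says that the empty set does not. *)
move=> VP; pose F : set_system (word A) := [set E |
  recognizes V (fun u v => v = w0 -> P u -> E u)].
have FF : ProperFilter F.
  split=> //; split=> [|E1 E2 F1 F2|E1 E2 E12].
  - by apply: recognizes_sub (recognizes_true A).
  - by apply: recognizes_sub (recognizes_and F1 F2) => u v [] uv1 uv2 *; split; auto.
  - by apply: recognizes_sub => u v uE *; apply/E12/uE.
have [U [UU FU]] := ultraFilterLemma FF.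
have Ucls (r : congruence A) : exists w, U [set u | r w u].
  have [s sP] := cong_finite_index r.
  (* Otherwise [U] contains the complements of the finitely many classes, whose intersection is
     empty. *)
  apply: contrapT => nU; have : U [set u | ~~ has (r^~ u) s].
    elim: s {sP} => [|w s IHs] /=; first exact: filterS filterT.
    have [rU|rU] := in_ultra_setVsetC [set u | r w u] UU; first by case: nU; exists w.
    by apply: filterS (filterI rU IHs) => u [/= /negP/negPf -> ->].
  move/filter_ex => [u /= /negP]; apply; have := sP u.
  by rewrite (eq_has (a2 := r^~ u)) // => w; rewrite equiv_sym.
pose c r := sval (cid (Ucls r)).
have cP (r : congruence A) : U [set u | r (c r) u] := svalP (cid (Ucls r)).
have coh : coherent (fun r : congruence A => \pi_(quo r) (c r)).
  move=> r r' rr' /=; have [u [/= ru r'u]] := filter_ex (filterI (cP r) (cP r')).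
  apply/eqmodP; apply: (@equiv_trans _ r' u); last by rewrite equiv_sym.
  by apply: rr'; apply: equiv_trans ru; apply/eqmodP; rewrite reprK.
exists (Profinite coh); split=> [r|S VS].
  have UP : U P.
    by apply: FU; apply: recognizes_sub (recognizes_true A).
  have [u [/= Pu ru]] := filter_ex (filterI UP (cP r)).
  by exists u; split=> //; rewrite /approx /proj_quo /=; apply/eqmodP.
apply/satisfies_wordP => h; set r := kernel_congruence h.
have Uh : U [set u | h u = h w0].
  by apply: FU; exists S, h; split=> // u v uv vw0 _; rewrite /= uv vw0.
have [u [/= uw0 /eqP ru]] := filter_ex (filterI Uh (cP r)).
by rewrite -uw0 -ru; apply/esym/extendE.
Qed.
End Recognition.

(** * Witnesses in [T_(k+1)] and [U_(k+1)] *)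

Section IntervalSemigroup.
Variable k : nat.

(* The zero is [None], and the factor [x_i ... x_(j-1)] of [x_0 ... x_(k-1)] is
   [Some (i, j)]; the pairs with [j <= i] annihilate everything. *)
Definition interval : Type := option ('I_k.+1 * 'I_k.+1).

HB.instance Definition _ := Finite.on interval.

Definition interval_mul (x y : interval) : interval :=
  if (x, y) is (Some (i, j), Some (j', l))
  then if [&& i < j, j == j' & j' < l] then Some (i, l) else None else None.

Fact interval_mulA : associative interval_mul.
Proof.
case=> [[a b]|] [[c d]|] [[e f]|] //; rewrite /interval_mul; last by case: ifP.
have [<-|/negPf de] := eqVneq d e; last by rewrite andbF; case: ifP => // _; rewrite de andbF.
have [<-|/negPf bc] := eqVneq b c; last by rewrite andbF; case: ifP => // _; rewrite bc andbF.
have [bd|bd] := boolP (b < d); last by rewrite !andbF.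
have [df|df] := boolP (d < f); last by rewrite andbF; case: ifP => //; rewrite !andbF.
rewrite /= eqxx (ltn_trans bd df) !andbT.
by have [ab|ab] := boolP (a < b); rewrite /= ?(ltn_trans ab bd) ?eqxx ?df.
Qed.

HB.instance Definition _ := isSemigroup.Build interval interval_mulA.
HB.instance Definition _ := isInhabited.Build interval (inhabits None).

Lemma interval_mulP (x y : interval) i l : x * y = Some (i, l) ->
  exists j, [/\ x = Some (i, j), y = Some (j, l), i < j & j < l].
Proof.
rewrite [x * y]/(interval_mul x y); case: x y => [[a b]|] [[c d]|] //=.
rewrite /interval_mul; case: ifP => // /and3P[ab /eqP bc cd] [<- <-].
by exists c; split; rewrite // -bc.
Qed.

Lemma interval_zero : is_zero (None : interval).
Proof. by case=> [[a b]|]. Qed.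

(** A nonzero product starts where its first factor starts and strictly before its last factor
    starts, so these factors differ. *)
Lemma interval_pvT : pvT interval.
Proof.
have xyx0 (x y : interval) : x * y * x = None.
  case E : (x * y * x) => [[i l]|] //.
  have [j [/interval_mulP[m [-> _ _ _]] [ij _]]] := interval_mulP E.
  by rewrite ij ltnn.
have xx0 (x : interval) : x * x = None.
  case E : (x * x) => [[i l]|] //.
  have [j [-> [ij _]]] := interval_mulP E.
  by rewrite ij ltnn.
by apply/pvTP; split=> [x y|x]; rewrite ?xyx0 xx0 //; exact: interval_zero.
Qed.

(** A single letter may be a pair with [j <= i], hence the first alternative; in a longer nonzero
    product every factor has positive length. *)
Lemma interval_size (u : word interval) i j : eval id u = Some (i, j) ->
  size (letters u) = 1%N \/ size (letters u) + i <= j.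
Proof.
elim/word_ind: u i => [a|a u IHu] i; first by left.
rewrite evalM => /interval_mulP[m [_ /IHu us im mj]]; right.
case: us => /= [->|us]; first exact: leq_ltn_trans im mj.
by apply: leq_trans us; rewrite addSnnS leq_add2l.
Qed.

Lemma interval_pvN : 0 < k -> pvN (ltn0Sn k) interval.
Proof.
move=> k_gt0; apply/pvNP => u ku.
case E : (eval id u) => [[i j]|]; last exact: interval_zero.
have [u1|uj] := interval_size E; first by move: ku; rewrite u1 ltnS leqNgt k_gt0.
have := leq_trans (leq_trans (leq_addr i _) uj) (ltn_ord j : j <= k).
by rewrite leqNgt ku.
Qed.

(** The two embeddings of ['I_k] produce the endpoints [i] and [i + 1]. *)
Definition factor : {multiplicative word 'I_k -> interval} :=
  eval (fun i : 'I_k => Some (widen_ord (leqnSn k) i, lift ord0 i) : interval).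

Lemma factor_Some w i j : factor w = Some (i, j) ->
  i < j /\ map val (letters w) = iota i (j - i).
Proof.
elim/word_ind: w i => [a|a w IHw] i.
  by case=> <- <-; rewrite /= /bump /= add1n subSnn.
rewrite gmulfM => /interval_mulP[m [[<- <-] /IHw[mj wE] im _]].
split; first exact: ltn_trans im mj.
move: wE mj; rewrite /= /bump /= add1n => -> aj; rewrite -[j - a]prednK ?subn_gt0 //=.
  by rewrite subnS.
exact: ltn_trans aj.
Qed.

Lemma factor_iota w i n : map val (letters w) = iota i n -> factor w != None.
Proof.
(* The induction needs the left endpoint, to match the preceding letter, and [a < b], to make the
   product nonzero. *)
suff : map val (letters w) = iota i n ->
    exists a b : 'I_k.+1, [/\ factor w = Some (a, b), a = i :> nat & a < b].
  by move=> H /H[a [b [-> _ _]]].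
elim/word_ind: w i n => [a|a w IHw] i [|n] //=.
  by case=> <- _; exists (widen_ord (leqnSn k) a), (lift ord0 a).
case=> <- /IHw[b [c [wE bE bc]]].
have aE : lift ord0 a = b by apply: val_inj; rewrite /= bE /bump /= add1n.
exists (widen_ord (leqnSn k) a), c; split=> //; last first.
  by apply: leq_trans (ltnW bc); rewrite bE.
have aw : factor (letter a) = Some (widen_ord (leqnSn k) a, b) by rewrite -aE.
by rewrite gmulfM wE aw
   [LHS]/(interval_mul _ _) /interval_mul eqxx bc /= bE leqnn.
Qed.

(** A nonzero value of [factor] determines the word. Hence the kernel class of [x_1 ... x_k] is a
    singleton, as [isolated_word] requires. *)
Lemma factor_prod_word (k_gt0 : 0 < k) u :
  factor u = factor (prod_word k_gt0) -> u = prod_word k_gt0.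
Proof.
have pE : map val (letters (prod_word k_gt0)) = iota 0 k by exact: val_enum_ord.
case E : (factor (prod_word k_gt0)) => [[i j]|]; last first.
  by have := factor_iota pE; rewrite E.
move=> /factor_Some[_ uE]; have [_ /= pE'] := factor_Some E.
by apply: val_inj; apply: (inj_map val_inj); rewrite /= uE -pE'.
Qed.
End IntervalSemigroup.

Section DisjointUnionSemigroup.
Variable k : nat.

(* The empty set plays the role of zero. *)
Definition disjoint_sets : Type := {set 'I_k}.

HB.instance Definition _ := Finite.on disjoint_sets.

Definition disjoint_union (x y : {set 'I_k}) : {set 'I_k} :=
  if [&& x != finset.set0, y != finset.set0 & (x :&: y)%SET == finset.set0]
  then (x :|: y)%SET else finset.set0.

Fact disjoint_unionA : associative (disjoint_union : disjoint_sets -> _ -> disjoint_sets).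
Proof.
move=> x y z; rewrite /disjoint_union.
have [->|x0] := eqVneq x finset.set0; first by rewrite !eqxx.
have [->|y0] := eqVneq y finset.set0; first by rewrite ?(eqxx, andbF) /= ?(eqxx, andbF).
have [->|z0] := eqVneq z finset.set0; first by rewrite ?(eqxx, andbF) /= ?(eqxx, andbF).
have -> : ((if true && ((y :&: z)%SET == finset.set0) then (y :|: z)%SET else finset.set0)
    != finset.set0) = ((y :&: z)%SET == finset.set0).
  by case: ifP => [/= ->|/= ->]; rewrite ?eqxx // finset.setU_eq0 (negPf y0).
rewrite /=; have [xy|xy] := boolP ((x :&: y)%SET == finset.set0);
  have [yz|yz] := boolP ((y :&: z)%SET == finset.set0);
  rewrite ?eqxx ?andbF //= ?finset.setIUr ?finset.setIUl ?finset.setU_eq0 ?xy ?yz ?(negPf x0)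
    ?(negPf xy) ?(negPf yz) ?andbF ?andbT //= ?finset.setUA //.
Qed.

HB.instance Definition _ := isSemigroup.Build disjoint_sets disjoint_unionA.
HB.instance Definition _ := isInhabited.Build disjoint_sets (inhabits finset.set0).

Let zero : disjoint_sets := finset.set0.

Lemma disjoint_setsM (x y : disjoint_sets) : x * y = disjoint_union x y.
Proof. by []. Qed.

Lemma disjoint_sets_zero : is_zero zero.
Proof. by move=> x; split; rewrite disjoint_setsM /disjoint_union eqxx ?andbF. Qed.

Lemma disjoint_sets_pvU : pvU disjoint_sets.
Proof.
apply/pvUP; split=> [x y|x].
  by rewrite !disjoint_setsM /disjoint_union andbCA finset.setIC finset.setUC.
suff -> : x * x = zero by exact: disjoint_sets_zero.
by rewrite disjoint_setsM /disjoint_union finset.setIid; case: eqP.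
Qed.

(** In a nonzero product the letters are nonempty disjoint sets, so cardinals add up and each is at
    least one. *)
Lemma disjoint_sets_size (u : word disjoint_sets) :
  eval id u != zero -> size (letters u) <= #|eval id u : {set 'I_k}|.
Proof.
elim/word_ind: u => [a|a u IHu]; first by rewrite eval_letter /= -finset.card_gt0.
rewrite evalM disjoint_setsM /disjoint_union; case: ifP; rewrite ?eqxx //.
case/and3P => a0 u0 /eqP au _; rewrite finset.cardsU au finset.cards0 subn0.
by rewrite -[leqLHS]/(1 + size (letters u))%N leq_add ?finset.card_gt0 ?IHu.
Qed.

Lemma disjoint_sets_long (u : word disjoint_sets) :
  k < size (letters u) -> eval id u = zero.
Proof.
move=> ku; apply/eqP; apply: contraTT ku => /disjoint_sets_size us.
by rewrite -leqNgt (leq_trans us) // -[leqRHS](card_ord k) max_card.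
Qed.

Lemma disjoint_sets_pvN : pvN (ltn0Sn k) disjoint_sets.
Proof. by apply/pvNP => u /disjoint_sets_long->; exact: disjoint_sets_zero. Qed.

Definition support : {multiplicative word 'I_k -> disjoint_sets} :=
  eval (fun i => [set i]%SET : disjoint_sets).

Lemma support_long w : k < size (letters w) -> support w = zero.
Proof.
move=> kw; rewrite -[LHS]/(eval (id \o _) w) -eval_word_map.
by apply: disjoint_sets_long; rewrite /= size_map.
Qed.

Lemma support_uniq w : uniq (letters w) -> support w = word_content w :> {set 'I_k}.
Proof.
elim/word_ind: w => [a _|a w IHw /= /andP[aw /IHw wE]].
  by apply/setP => b; rewrite !inE.
have -> : word_content (letter a * w) = ([set a] :|: word_content w)%SET.
  by apply/setP => b; rewrite !inE.
rewrite gmulfM disjoint_setsM wE /disjoint_union.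
have -> : support (letter a) = [set a]%SET by [].
rewrite (_ : [&& _, _ & _]) //; apply/and3P; split.
- by rewrite -finset.card_gt0 finset.cards1.
- case: w aw {wE IHw} => -[//|b s] s0 _; apply/finset.set0Pn; exists b.
  by rewrite inE mem_head.
- by rewrite finset.setI_eq0 finset.disjoints1 inE.
Qed.

Lemma support_prod_word (k_gt0 : 0 < k) : support (prod_word k_gt0) != zero.
Proof.
rewrite support_uniq ?enum_uniq //; apply/finset.set0Pn.
by exists (Ordinal k_gt0); rewrite inE mem_enum.
Qed.
End DisjointUnionSemigroup.

(** * Codes *)

(** A letter shared by two different blocks would occur twice in the concatenation. *)
Lemma flatten_uniq_inj (T B : eqType) (g : T -> seq B) (s : seq T) x y b :
  uniq (flatten (map g s)) -> x \in s -> y \in s -> b \in g x -> b \in g y -> x = y.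
Proof.
elim: s => //= a s IHs; rewrite cat_uniq => /and3P[_ /hasPn gas us].
have gs z : z \in s -> b \in g z -> b \notin g a.
  by move=> zs bz; apply: gas; apply/flatten_mapP; exists z.
rewrite !inE => /predU1P[->|xs] /predU1P[->|ys] // bx b_y; last exact: IHs.
  by rewrite (negPf (gs y ys b_y)) in bx.
by rewrite (negPf (gs x xs bx)) in b_y.
Qed.

Lemma flatten_uniq (T B : eqType) (g : T -> seq B) (s : seq T) :
  (forall x, g x != [::]) -> uniq (flatten (map g s)) ->
  uniq s /\ (forall x, x \in s -> uniq (g x)).
Proof.
move=> g0; elim: s => //= a s IHs; rewrite cat_uniq => /and3P[ga /hasPn gas us].
have [-> gs] := IHs us; split=> [|x]; last by rewrite inE => /predU1P[->|/gs].
rewrite andbT; apply/negP => a_s; case E : (g a) (g0 a) => [//|b t] _.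
have /gas : b \in flatten (map g s) by apply/flatten_mapP; exists a; rewrite ?E ?mem_head.
by rewrite E mem_head.
Qed.

Lemma flatten_inj (T B : eqType) (g : T -> seq B) (u w : seq T) :
  (forall x, g x != [::]) -> uniq (flatten (map g w)) -> {subset u <= w} ->
  flatten (map g u) = flatten (map g w) -> u = w.
Proof.
move=> g0 uw; have inj := flatten_uniq_inj uw.
(* The induction runs over a second word [v] with letters in [w], while [w] stays fixed in the
   injectivity statement. *)
have : {subset w <= w} by [].
move: {1 4 5}w => v; elim: u v => [|a u IHu] [|b v] vw uw' //=.
- by case: (g b) (g0 b).
- by case: (g a) (g0 a).
have [aw bw] : a \in w /\ b \in w by split; [apply: uw' | apply: vw]; exact: mem_head.
case Ea : (g a) (g0 a) => [//|c s] _; case Eb : (g b) (g0 b) => [//|d t] _ E.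
have ab : a = b.
  apply: (inj a b c) => //; first by rewrite Ea mem_head.
  by case: E => -> _; rewrite Eb mem_head.
move: E; rewrite -Ea -Eb ab => /(congr1 (drop (size (g b)))).
rewrite !drop_size_cat // => /IHu -> // x xs.
  by apply: vw; rewrite inE xs orbT.
by apply: uw'; rewrite inE xs orbT.
Qed.

(* Since [e] will have no repetition, the last condition ensures that only words
   over [w] can be mapped to permutations of [e]. *)
Lemma code_exists (T B : eqType) (w : seq T) (e : seq B) :
  uniq w -> w != [::] -> size w <= size e ->
  exists g : T -> seq B, [/\ forall x, g x != [::], flatten (map g w) = e &
    forall x, x \notin w -> ~~ uniq (g x)].
Proof.
elim: w e => [//|a w IHw] [//|b e] /= /andP[aw uw] _; rewrite ltnS => we.
case: w => [|a' w] in IHw aw uw we *.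
  (* The last letter of [w] takes all that remains of [e]; letters outside [w] get a repetition. *)
  exists (fun x => if x == a then b :: e else [:: b; b]).
  split=> [x||x]; rewrite ?eqxx ?cats0 //; first by case: ifP.
  by rewrite inE => /negPf->; rewrite /= inE eqxx.
have [g [g0 ge gw]] := IHw e uw isT we.
exists (fun x => if x == a then [:: b] else g x); split=> [x||x].
- by case: ifP.
- rewrite map_cons eqxx -ge -[LHS]/([:: b] ++ flatten _); congr (_ :: flatten _).
  apply: (eq_in_map _ g (a' :: w)).1 => x xw /=.
  by case: eqP => // xa; rewrite -xa xw in aw.
- by rewrite inE negb_or => /andP[/negPf-> /gw].
Qed.

(** The image of [u] has no repetition, so neither has [u], and all its letters lie in [w].
    Conversely, a block of a letter of [w] meets some block of [u], and the two must coincide. *)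
Lemma code_perm (T B : eqType) (g : T -> seq B) (u w : seq T) :
  (forall x, g x != [::]) -> (forall x, x \notin w -> ~~ uniq (g x)) ->
  uniq w -> uniq (flatten (map g w)) ->
  perm_eq (flatten (map g u)) (flatten (map g w)) -> perm_eq u w.
Proof.
move=> g0 gw uw ugw uguw.
have ugu : uniq (flatten (map g u)) by rewrite (perm_uniq uguw).
have [uu gu] := flatten_uniq g0 ugu.
have sub x : x \in u -> x \in w by apply: contraTT => /gw; apply: contra => /gu.
apply: uniq_perm => // x; apply/idP/idP => [/sub //|xw].
case E : (g x) (g0 x) => [//|b t] _.
have /flatten_mapP[y yu b_y] : b \in flatten (map g u).
  by rewrite (perm_mem uguw); apply/flatten_mapP; exists x; rewrite ?E ?mem_head.
by rewrite (flatten_uniq_inj ugw xw (sub y yu) (b := b)) ?E ?mem_head.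
Qed.

(** Pulling back along [f] turns a separation of [x_1 ... x_k] into one of [w]: the second property
    serves [pvT_product], the third [pvU_expansion]. *)
Lemma code_word (T : choiceType) (k : nat) (k_gt0 : 0 < k) (w : word T) :
  uniq (letters w) -> size (letters w) <= k ->
  exists f : {multiplicative word T -> word 'I_k},
    [/\ f w = prod_word k_gt0,
      forall u, f u = prod_word k_gt0 -> u = w &
      forall u, perm_eq (letters (f u)) (letters (prod_word k_gt0)) ->
        perm_eq (letters u) (letters w)].
Proof.
move=> uw wk; have w0 : letters w != [::] by case: (w) => -[].
have [|g [g0 gw gNw]] := @code_exists _ _ _ (enum 'I_k) uw w0.
  by rewrite size_enum_ord.
have g1 x : ~~ nilp (g x) by rewrite /nilp size_eq0.
pose f : {multiplicative word T -> word 'I_k} := eval (fun x => Word (g1 x)).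
have fE u : letters (f u) = flatten (map g (letters u)) by exact: letters_eval.
have ugw : uniq (flatten (map g (letters w))) by rewrite gw enum_uniq.
have perm u : perm_eq (letters (f u)) (letters (prod_word k_gt0)) ->
    perm_eq (letters u) (letters w).
  by rewrite fE /= -gw; exact: code_perm.
exists f; split=> // [|u uE]; first by apply: val_inj; rewrite /= fE.
apply: val_inj; apply: (flatten_inj g0 ugw).
  by move=> x; rewrite -(perm_mem (perm u _)) // uE.
by rewrite gw -fE uE.
Qed.

(** * Product identities *)

Section Main.
Variables (V : semigroup_class) (V_pseudovariety : pseudovariety V).

Lemma nilpotent_in_class (k : nat) (T : finSemigroupType) :
  pvT T -> pvN (ltn0Sn k) T ->
  (forall w : word T, uniq (letters w) -> size (letters w) <= k ->
    recognizes V (fun u v => v = w -> eval id u = eval id v)) ->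
  V T.
Proof.
move=> TT TN H; apply: (recognizes_eval V_pseudovariety).
(* Bounded sequences provide a finite index set; for the empty and the repetitive ones the condition
   is void. *)
have [|S [h [VS hR]]] := @recognizes_meet _ V_pseudovariety T (k.-bseq T)
    (fun b u v => letters v = b -> uniq b -> eval id u = eval id v).
  move=> b; have [ub|nub] := boolP (uniq b); last first.
    by apply: recognizes_sub (recognizes_true V_pseudovariety T).
  have [b0|b0] := boolP (nilp b).
    apply: recognizes_sub (recognizes_true V_pseudovariety T) => u v _ vb.
    by have := valP v; rewrite /= vb b0.
  apply: recognizes_sub (H (Word b0) ub (size_bseq b)) => u v uv vb _.
  by apply: uv; exact: val_inj.
exists S, h; split=> // u v uv.
have good (w : word T) : uniq (letters w) && (size (letters w) <= k) \/ is_zero (eval id w).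
  have [uw|uw] := boolP (uniq (letters w)); last by right; exact: zero_not_uniq.
  have [wk|wk] := leqP (size (letters w)) k; first by left.
  by right; move/pvNP: TN; apply.
have sym (u' v' : word T) : h u' = h v' -> uniq (letters v') && (size (letters v') <= k) ->
    eval id u' = eval id v'.
  by move=> /hR uv' /andP[uv1 v'k]; apply: (uv' (Bseq v'k)).
(* The separation fixes its right-hand word, so [u] and [v] are exchanged if only [u] is short and
   without repetition; if neither is, both values are zero. *)
have [gv|zv] := good v; first exact: sym.
have [gu|zu] := good u; first exact/esym/sym.
exact: is_zero_uniq.
Qed.

Lemma size_prod_word k (k_gt0 : 0 < k) : size (letters (prod_word k_gt0)) = k.
Proof. exact: size_enum_ord. Qed.

Lemma pvT_product k (k_gt0 : 0 < k) :
  ~ subclass (pvT_ (ltn0Sn k)) V ->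
  exists rho : profinite_word 'I_k,
    nontrivial (product_identity k_gt0 rho) /\
    class_satisfies V (product_identity k_gt0 rho).
Proof.
set p := prod_word k_gt0 => TV.
have [|rho [rhoP Vrho]] := @compactness V V_pseudovariety 'I_k p (fun w => w <> p).
  move=> rec; apply: TV => T [TT TN]; apply: nilpotent_in_class TT TN _ => w uw wk.
  have [f [fw fu _]] := code_word k_gt0 uw wk.
  apply: recognizes_sub (recognizes_subst f rec) => u v uv vw.
  by rewrite vw; congr eval; apply: fu; apply: contrapT; apply: uv; rewrite vw.
exists rho; split=> // pE; have {pE} rhoE : of_word p = rho := pE.
(* Modulo this congruence [p] is alone in its class, whereas [rho] has a representative other than
   [p]. *)
have [w [wp]] := rhoP (length_congruence _ k).
by rewrite -rhoE => /of_word_approx wE; apply: wp; rewrite wE ?size_prod_word.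
Qed.

(** If [interval k] were in [V], then [rho] would be represented by [x_1 ... x_k] modulo the kernel
    of [factor], where this word is isolated. *)
Lemma product_pvT k (k_gt0 : 0 < k) (rho : profinite_word 'I_k) :
  nontrivial (product_identity k_gt0 rho) ->
  class_satisfies V (product_identity k_gt0 rho) ->
  ~ subclass (pvT_ (ltn0Sn k)) V.
Proof.
move=> rhoN Vrho TV; apply: rhoN.
have : V (interval k) by apply: TV; split; [exact: interval_pvT | exact: interval_pvN].
move=> /Vrho/satisfies_wordP/(_ (factor k)) pE; apply/esym.
have wE : repr (proj_quo rho (kernel_congruence (factor k))) = prod_word k_gt0.
  exact/factor_prod_word/esym.
have rp : approx (kernel_congruence (factor k)) rho (prod_word k_gt0).
  by rewrite -wE; exact: approx_repr.
by apply: isolated_word rp => u /eqP/esym; exact: factor_prod_word.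
Qed.

(** Compactness is applied to the regular words longer than [k]. If [h] separated [p] from these,
    then [h] together with all [h \o d i] would separate [p] from every word that is not a
    permutation of it. *)
Lemma pvU_expansion k (k_gt0 : 0 < k) :
  ~ subclass (pvU_ (ltn0Sn k)) V ->
  exists rho : profinite_word 'I_k,
    [/\ regular rho, longer_than k rho & class_satisfies V (product_identity k_gt0 rho)].
Proof.
set p := prod_word k_gt0 => UV.
pose P (w : word 'I_k) := word_content w = [set: 'I_k]%SET /\ k < size (letters w).
have [|rho [rhoP Vrho]] := @compactness V V_pseudovariety 'I_k p P; last first.
  exists rho; split=> //.
    have [w [[wf _] rw]] := rhoP (content_congruence _).
    by move/(approx_cong _ (approx_repr _ rho))/eqP: rw; rewrite /regular /content => ->.
  by apply/longer_thanP; have [w [[_ wk] rw]] := rhoP (length_congruence _ k); exists w.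
case=> S [h [VS hP]].
(* An expansion of [p] omitting [x_i] would also be an expansion of
   [x_0 ... x_i x_i ... x_(k-1)], which is regular. *)
pose d (i : 'I_k) : {multiplicative word 'I_k -> word 'I_k} :=
  eval (fun j => if j == i then letter i * letter i else letter j).
have dNi i w : i \notin letters w -> d i w = w.
  elim/word_ind: w => [j|j w IHw]; rewrite inE ?negb_or.
    by rewrite /d /= eval_letter eq_sym => /negPf->.
  move=> /andP[ij /IHw wE]; rewrite gmulfM wE; congr (_ * _).
  by rewrite /d /= eval_letter eq_sym (negPf ij).
have dP i : P (d i p).
  have dE : letters (d i p) = flatten [seq if j == i then [:: i; i] else [:: j] | j <- enum 'I_k].
    by rewrite letters_eval; congr flatten; apply: eq_map => j; case: ifP.
  split.
    apply/setP => j; rewrite !inE dE; apply/flatten_mapP; exists j; rewrite ?mem_enum //.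
    by case: eqP => [->|_]; rewrite mem_head.
  (* The block of [i] contributes two and the [k - 1] other letters one each, giving length
     [k + 1]. *)
  rewrite dE size_flatten /shape -map_comp sumnE big_map big_enum /=.
  rewrite (bigD1 i) //= eqxx /= (eq_bigr (fun=> 1%N)) => [|j /negPf-> //].
  by rewrite sum1_card cardC1 card_ord -{1}(prednK k_gt0).
have rec : recognizes V (fun u v => v = p -> perm_eq (letters u) (letters p)).
  have [||S' [h' [VS' h'R]]] := @recognizes_and _ V_pseudovariety 'I_k
      (fun u v => h u = h v) (fun u v => forall i, h (d i u) = h (d i v)).
  - by exists S, h.
  - apply: (@recognizes_meet _ V_pseudovariety _ _ (fun i u v => h (d i u) = h (d i v))) => i.
    by exists S, (h \o d i).
  exists S', h'; split=> // u v /h'R[uv duv] vp; rewrite {}vp in uv duv.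
  have uf i : i \in letters u.
    (* If [i] is missing, [d i] fixes [u], so [h] takes the same value at [d i p], [u] and [p]. *)
    apply: contrapT => /negP iu; apply: (hP (d i p) p _ erefl (dP i)).
    by rewrite -duv dNi.
  (* As [u] contains all [k] letters, it satisfies [P] if it is longer than [k], and is a
     permutation of [p] otherwise. *)
  have uk : size (letters u) <= k.
    rewrite leqNgt; apply/negP => ku; apply: hP uv erefl _; split=> //.
    by apply/setP => i; rewrite !inE uf.
  have pu : {subset letters p <= letters u} by move=> i _.
  have up : size (letters u) <= size (letters p) by rewrite size_prod_word.
  have [_ pE] := uniq_min_size (enum_uniq _) pu up.
  rewrite perm_sym; apply: uniq_perm (enum_uniq _) _ pE.
  exact: leq_size_uniq (enum_uniq _) pu up.
apply: UV => T [TU TN]; apply: nilpotent_in_class (pvU_pvT TU) TN _ => w uw wk.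
have [f [fw _ fu]] := code_word k_gt0 uw wk.
apply: recognizes_sub (recognizes_subst f rec) => u v uv vw.
have /pvUP[TC _] := TU.
by rewrite vw; apply: eval_perm => //; apply: fu; apply: uv; rewrite vw.
Qed.

(** A common representative for length and [support] is longer than [k], so [rho] has support zero
    in [disjoint_sets k], unlike [x_1 ... x_k]. *)
Lemma expansion_pvU k (k_gt0 : 0 < k) (rho : profinite_word 'I_k) :
  longer_than k rho -> class_satisfies V (product_identity k_gt0 rho) ->
  ~ subclass (pvU_ (ltn0Sn k)) V.
Proof.
move=> /longer_thanP[w rw wk] Vrho UV.
have : V (disjoint_sets k).
  by apply: UV; split; [exact: disjoint_sets_pvU | exact: disjoint_sets_pvN].
move=> /Vrho/satisfies_wordP/(_ (support k)).
have [u [ru ru']] :=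
  approx_both (length_congruence _ k) (kernel_congruence (support k)) rho.
rewrite (extendE ru') [RHS]support_long; first by apply/eqP/support_prod_word.
by move/(approx_cong _ rw)/same_boundedP: ru => [<-|[]].
Qed.
End Main.

Theorem theoremB (V : semigroup_class) (k : nat)
    (V_pseudovariety : pseudovariety V) (k_gt0 : 0 < k) :
  (~ subclass (pvT_ (ltn0Sn k)) V <->
     exists rho : profinite_word 'I_k,
       nontrivial (product_identity k_gt0 rho) /\
       class_satisfies V (product_identity k_gt0 rho))
  /\
  ((~ subclass (pvU_ (ltn0Sn k)) V <->
      exists rho : profinite_word 'I_k,
        longer_than k rho /\
        class_satisfies V (product_identity k_gt0 rho))
   /\
   (~ subclass (pvU_ (ltn0Sn k)) V <->
      exists rho : profinite_word 'I_k,
        [/\ regular rho, longer_than k rho &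
            class_satisfies V (product_identity k_gt0 rho)]))
  /\
  (~ subclass pvT V <->
     exists (n : nat) (n_gt0 : 0 < n) (rho : profinite_word 'I_n),
       nontrivial (product_identity n_gt0 rho) /\
       class_satisfies V (product_identity n_gt0 rho))
  /\
  (~ subclass pvU V <->
     exists (n : nat) (n_gt0 : 0 < n) (rho : profinite_word 'I_n),
       [/\ regular rho, longer_than n rho &
           class_satisfies V (product_identity n_gt0 rho)]).
Proof.
have card_gt0 (S : finSemigroupType) : 0 < #|S|.
  by have [x] := @is_inhabited S; apply/card_gt0P; exists x.
split; last split; [|split|split].
- split=> [|[rho [rhoN Vrho]]]; first exact: pvT_product.
  exact: product_pvT rhoN Vrho.
- split=> [/(pvU_expansion V_pseudovariety k_gt0)[rho [_ rk Vrho]]|[rho [rk Vrho]]].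
    by exists rho.
  exact: expansion_pvU rk Vrho.
- split=> [|[rho [_ rk Vrho]]]; first exact: pvU_expansion.
  exact: expansion_pvU rk Vrho.
- split=> [TV|[n [n_gt0 [rho [rhoN Vrho]]]] TV].
    have [S [ST SV]] : exists S, pvT S /\ ~ V S.
      by apply: contrapT => nS; apply: TV => S ST; apply: contrapT => SV; apply: nS; exists S.
    (* By [pvT_nilpotent], the member [S] of [T] outside [V] already lies in [T_(k+1)] for
       [k = #|S|], so this cardinality serves as the arity. *)
    exists #|S|, (card_gt0 S); apply: pvT_product => // TSV; apply: SV; apply: TSV.
    by split=> //; exact: pvT_nilpotent.
  by apply: (product_pvT rhoN Vrho) => S [ST _]; exact: TV.
- split=> [UV|[n [n_gt0 [rho [_ rk Vrho]]]] UV].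
    have [S [SU SV]] : exists S, pvU S /\ ~ V S.
      by apply: contrapT => nS; apply: UV => S SU; apply: contrapT => SV; apply: nS; exists S.
    exists #|S|, (card_gt0 S); apply: pvU_expansion => // USV; apply: SV; apply: USV.
    by split=> //; exact/pvT_nilpotent/pvU_pvT.
  by apply: (expansion_pvU rk Vrho) => S [SU _]; exact: UV.
Qed.
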